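(* Let $m,n\in\mathbb{N}$ with $m\le n$, and let $p,q\in[1,\infty]$ with $p\le q$. For all $\mu\in \mathrm{M}^q(\mathbb{R}^m)$ and $\nu\in \mathrm{M}^q(\mathbb{R}^n)$, $$\widehat{\mathrm{W}}_p(\mu,\nu)\le\widehat{\mathrm{W}}_q(\mu,\nu).$$
   Context: $\mathrm{M}(\mathbb{R}^n)$ is the set of Borel probability measures on $\mathbb{R}^n$, and $\mathrm{M}^p(\mathbb{R}^n)$ the subset of those with finite $p$th moment, $\int\|x\|_2^p\,d\mu(x)<\infty$ (for $p=\infty$: the $\mu$-essential supremum of $\|x\|_2$ is finite). For $m\le n$, $\mathrm{O}(m,n)=\{V\in\mathbb{R}^{m\times n}: VV^{T}=I_m\}$. For $V\in \mathrm{O}(m,n)$, $b\in\mathbb{R}^m$, $\varphi_{V,b}:\mathbb{R}^n\to\mathbb{R}^m$ is $\varphi_{V,b}(x)=Vx+b$, and $\varphi_{V,b}(\mu)=\mu\circ\varphi_{V,b}^{-1}$ is the pushforward measure. For $\mu\in \mathrm{M}^p(\mathbb{R}^m)$ and $\nu\in \mathrm{M}^p(\mathbb{R}^n)$, $$\Phi^-(\nu,m)=\{\beta\in \mathrm{M}(\mathbb{R}^m): \varphi_{V,b}(\nu)=\beta \text{ for some } V\in \mathrm{O}(m,n),\ b\in\mathbb{R}^m\},$$ $$\Phi^+_p(\mu,n)=\{\alpha\in \mathrm{M}^p(\mathbb{R}^n): \varphi_{V,b}(\alpha)=\mu \text{ for some } V\in \mathrm{O}(m,n),\ b\in\mathbb{R}^m\}.$$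 For $\mu,\nu\in \mathrm{M}^p(\mathbb{R}^n)$, the $p$-Wasserstein metric is $$\mathrm{W}_p(\mu,\nu)=\Bigl[\inf_{\gamma\in\Gamma(\mu,\nu)}\int_{\mathbb{R}^{2n}}\|x-y\|_2^p\,d\gamma(x,y)\Bigr]^{1/p},$$ where $\Gamma(\mu,\nu)$ is the set of couplings of $\mu$ and $\nu$; for $p=\infty$ the bracketed expression is replaced by the infimum over couplings of the $\gamma$-essential supremum of $\|x-y\|_2$. The augmented $p$-Wasserstein distance $\widehat{\mathrm{W}}_p(\mu,\nu)$ between $\mu\in \mathrm{M}^p(\mathbb{R}^m)$ and $\nu\in \mathrm{M}^p(\mathbb{R}^n)$ is the common value $$\widehat{\mathrm{W}}_p(\mu,\nu)=\inf_{\beta\in\Phi^-(\nu,m)} \mathrm{W}_p(\mu,\beta)=\inf_{\alpha\in\Phi^+_p(\mu,n)} \mathrm{W}_p(\alpha,\nu).$$ (These two infima are equal.) *)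

(* Defs.v *)
From HB Require Import structures.
From mathcomp Require Import all_boot all_order all_algebra.
From mathcomp Require Import all_classical all_reals all_analysis.
From mathcomp Require Import ess_sup_inf.
Set Implicit Arguments.
Unset Strict Implicit.
Unset Printing Implicit Defensive.
Import Order.TTheory GRing.Theory Num.Theory.
Import numFieldNormedType.Exports.
Local Open Scope classical_set_scope.
Local Open Scope ring_scope.
Local Open Scope ereal_scope.

(* R^n as column vectors with the Borel sigma-algebra (the matrix topology is
   the product topology). *)
Definition euclid (R : realType) (n : nat) :=
  g_sigma_algebraType (@open 'cV[R]_n).

HB.instance Definition _ (R : realType) (n : nat) :=
  Measurable.on (euclid R n).

(* The library norm on matrices is the sup norm, hence this definition. *)
Definition norm2 (R : realType) (n : nat) (x : 'cV[R]_n) : R :=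
  Num.sqrt (\sum_(i < n) x i ord0 ^+ 2)%R.

(* A measure is a function on all subsets, only meaningful on measurable ones,
   so equality of measures is tested on measurable sets. *)
Definition pushes_to d d' (T : measurableType d) (T' : measurableType d')
    (R : realType) (f : T -> T') (mu : probability T R)
    (mu' : probability T' R) : Prop :=
  forall A : set T', measurable A -> pushforward mu f A = mu' A.

(* The exponent ranges over \bar R; -oo is outside the intended range
   [1, +oo] and gets a junk value, here and in [wasserstein]. *)
Definition finite_moment (R : realType) (n : nat) (p : \bar R)
    (mu : probability (euclid R n) R) : Prop :=
  match p with
  | r%:E => \int[mu]_x ((norm2 x) `^ r)%:E < +oo
  | +oo => ess_sup mu (fun x : euclid R n => (norm2 x)%:E) < +oo
  | -oo => False
  end.

Definition stiefel (R : realType) (m n : nat) (V : 'M[R]_(m, n)) : Prop :=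
  V *m V^T = 1%:M.

Definition affine_map (R : realType) (m n : nat) (V : 'M[R]_(m, n))
    (b : 'cV[R]_m) (x : euclid R n) : euclid R m :=
  (V *m x + b)%R.

Definition Phi_minus (R : realType) (m n : nat)
    (nu : probability (euclid R n) R) : set (probability (euclid R m) R) :=
  [set beta | exists (V : 'M[R]_(m, n)) (b : 'cV[R]_m),
     stiefel V /\ pushes_to (affine_map V b) nu beta].

Definition Phi_plus (R : realType) (m n : nat) (p : \bar R)
    (mu : probability (euclid R m) R) : set (probability (euclid R n) R) :=
  [set alpha | finite_moment p alpha /\
     exists (V : 'M[R]_(m, n)) (b : 'cV[R]_m),
       stiefel V /\ pushes_to (affine_map V b) alpha mu].

(* Couplings live on the product sigma-algebra, which is the Borel
   sigma-algebra of R^n x R^n since R^n is second countable. *)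
Definition coupling (R : realType) (n : nat)
    (mu nu : probability (euclid R n) R) :
    set (probability (euclid R n * euclid R n)%type R) :=
  [set gamma | pushes_to fst gamma mu /\ pushes_to snd gamma nu].

Definition wasserstein (R : realType) (n : nat) (p : \bar R)
    (mu nu : probability (euclid R n) R) : \bar R :=
  match p with
  | r%:E =>
      (ereal_inf [set \int[gamma]_xy ((norm2 (xy.1 - xy.2)%R) `^ r)%:E
                 | gamma in coupling mu nu]) `^ r^-1
  | +oo =>
      ereal_inf [set ess_sup gamma
                       (fun xy : euclid R n * euclid R n =>
                          (norm2 (xy.1 - xy.2)%R)%:E)
                | gamma in coupling mu nu]
  | -oo => 0
  end.

(* The augmented Wasserstein distance is the common value of the two infima
   [augW_minus] (over projections of nu) and [augW_plus] (over embeddings of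
   mu). Their equality is a separate theorem, so neither is preferred here. *)
Definition augW_minus (R : realType) (m n : nat) (p : \bar R)
    (mu : probability (euclid R m) R) (nu : probability (euclid R n) R) :
    \bar R :=
  ereal_inf [set wasserstein p mu beta | beta in @Phi_minus R m n nu].

Definition augW_plus (R : realType) (m n : nat) (p : \bar R)
    (mu : probability (euclid R m) R) (nu : probability (euclid R n) R) :
    \bar R :=
  ereal_inf [set wasserstein p alpha nu | alpha in @Phi_plus R m n p mu].

(* Main.v *)
(** For a fixed coupling, [W_p] is the [L^p] norm of the distance function on a
    probability space, and these norms increase with [p] (Hölder). Passing to
    infima over couplings gives [W_p <= W_q]; the same monotonicity applied to
    moments gives the inclusion of the [q]-embeddings in the [p]-embeddings. *)
Require Import Defs.
From mathcomp Require Import all_boot all_order all_algebra.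
From mathcomp Require Import all_classical all_reals all_analysis.
From mathcomp Require Import ess_sup_inf measurable_realfun.
Import Order.TTheory GRing.Theory Num.Theory.
Import numFieldNormedType.Exports.
Local Open Scope classical_set_scope.
Local Open Scope ereal_scope.

Lemma le_poweR (R : realType) (r : R) (x y : \bar R) :
  (0 <= r)%R -> 0 <= x -> x <= y -> x `^ r <= y `^ r.
Proof.
move=> r0 x0 xy; apply: gt0_ler_poweR => //; rewrite in_itv/= leey andbT//.
exact: le_trans xy.
Qed.

Lemma poweRK (R : realType) (r : R) (x : \bar R) :
  r != 0%R -> 0 <= x -> (x `^ r) `^ r^-1 = x.
Proof. by move=> r0 x0; rewrite -poweRrM divff// poweRe1. Qed.

Lemma poweRVK (R : realType) (r : R) (x : \bar R) :
  r != 0%R -> 0 <= x -> (x `^ r^-1) `^ r = x.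
Proof. by move=> r0 x0; rewrite -poweRrM mulVf// poweRe1. Qed.

(** On [[0, +oo]] the power [r] is an increasing bijection with inverse the power [r^-1], so it
    commutes with infima, including that of the empty set. *)
Lemma poweR_ereal_inf (R : realType) (r : R) (S : set (\bar R)) :
  (0 < r)%R -> (forall x, S x -> 0 <= x) ->
  ereal_inf S `^ r = ereal_inf [set x `^ r | x in S].
Proof.
move=> r0 S0; have rN0 : r != 0%R by rewrite gt_eqF.
have rV0 : (0 <= r^-1)%R by rewrite invr_ge0 ltW.
have infS0 : 0 <= ereal_inf S by exact/ereal_infP.
set I := ereal_inf (image _ _).
have I0 : 0 <= I by apply/ereal_infP => _ [x _ <-]; exact: poweR_ge0.
apply/eqP; rewrite eq_le; apply/andP; split.
  apply/ereal_infP => _ [x Sx <-].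
  by apply: le_poweR; [exact: ltW|by []|exact: ereal_inf_lbound].
rewrite -(poweRVK _ _ I rN0 I0).
apply: le_poweR; [exact: ltW|exact: poweR_ge0|].
apply/ereal_infP => x Sx; rewrite -(poweRK _ _ x rN0 (S0 _ Sx)).
by apply: le_poweR => //; apply: ereal_inf_lbound; exists x.
Qed.

Lemma Lnorm_nneg (d : measure_display) (T : measurableType d) (R : realType)
    (mu : {measure set T -> \bar R}%R) (r : R) (f : T -> R) :
  (forall x, (0 <= f x)%R) ->
  'N[mu]_r%:E[EFin \o f] = (\int[mu]_x (f x `^ r)%:E) `^ r^-1.
Proof.
by move=> f0; rewrite unlock /Lnorm; under eq_integral do
  rewrite /= ger0_norm//.
Qed.

(** [Lnorm] at [+oo] is the essential supremum only when the whole space has positive mass, which a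
    probability measure guarantees. *)
Lemma Lnormy_probability (d : measure_display) (T : measurableType d)
    (R : realType) (P : probability T R) (f : T -> \bar R) :
  'N[P]_+oo[f] = ess_sup P (abse \o f).
Proof.
have P0 : 0 < P setT by rewrite probability_setT lte01.
by rewrite unlock /Lnorm ifT.
Qed.

Lemma Lnormy_nneg (d : measure_display) (T : measurableType d) (R : realType)
    (P : probability T R) (f : T -> R) :
  (forall x, (0 <= f x)%R) ->
  'N[P]_+oo[EFin \o f] = ess_sup P (EFin \o f).
Proof.
move=> f0; rewrite Lnormy_probability; congr ess_sup.
by apply/funext => x /=; rewrite ger0_norm.
Qed.

Lemma le_Lnorm_probability (d : measure_display) (T : measurableType d)
    (R : realType) (P : probability T R) (p q : \bar R) (f : T -> R) :
  measurable_fun setT f -> 1 <= p -> p <= q ->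
  'N[P]_p[EFin \o f] <= 'N[P]_q[EFin \o f].
Proof.
move=> mf; case: p q => [p| |//] [q| |]// p1; last 1 first.
- have p0 : (0 < p)%R by rewrite (lt_le_trans ltr01).
  have pN0 : p != 0%R by rewrite gt_eqF.
  (* With [q = +oo], only a finite essential supremum [c] needs an argument: [+oo] bounds everything
     and [-oo] contradicts nonnegativity. *)
  move=> _; case E : ('N[P]_+oo[_]) => [c| |]; [|exact: leey|]; last first.
    by have := Lnorm_ge0 P +oo (EFin \o f); rewrite E.
  have c0 : (0 <= c)%R by rewrite -lee_fin -E Lnorm_ge0.
  move: E; rewrite Lnormy_probability unlock /Lnorm => E.
  have fc : \forall x \ae P, (abse \o (EFin \o f)) x <= c%:E.
    by apply/ess_supP; rewrite E.
  rewrite -(poweRK _ p c%:E pN0)//; apply: le_poweR.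
  + by rewrite invr_ge0 ltW.
  + by apply: integral_ge0 => x _; exact: poweR_ge0.
  (* Since the total mass is 1, the power [c ^ p] is the integral of a constant that dominates the
     integrand almost everywhere. *)
  rewrite -[leRHS]mule1 -(@probability_setT _ _ _ P) -integral_cst//.
  apply: ae_ge0_le_integral => //.
  + by move=> x _; exact: poweR_ge0.
  + apply: (measurableT_comp (measurable_poweR p)).
    by apply: measurableT_comp => //; exact/measurable_EFinP.
  + by move=> x _; exact: poweR_ge0.
  + apply: filterS fc => x fxc _.
    by apply: le_poweR => //; exact: ltW.
(* The case [p = q] is split off: Hölder is used with exponent [r = q / p], whose conjugate
   [(1 - r^-1)^-1] is positive only for [r > 1]. *)
rewrite lee_fin le_eqVlt => /predU1P[->//|pq].
have p0 : (0 < p)%R by rewrite (lt_le_trans ltr01).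
have pN0 : p != 0%R by rewrite gt_eqF.
have q0 : (0 < q)%R by exact: lt_trans pq.
pose r := (q / p)%R.
have r1 : (1 < r)%R by rewrite /r ltr_pdivlMr// mul1r.
have r0 : (0 < r)%R by exact: lt_trans r1.
have s0 : (0 < (1 - r^-1)^-1)%R by rewrite invr_gt0 subr_gt0 invf_lt1.
have rs1 : (r^-1 + (1 - r^-1)^-1^-1 = 1)%R by rewrite invrK addrC subrK.
have mfp : measurable_fun setT (fun x => `|f x| `^ p)%R.
  apply: (@measurableT_comp _ _ _ _ _ _ (@powR R ^~ p)) => //.
  exact: measurableT_comp.
(* Hölder for the product of [|f| ^ p] and the constant 1, whose norm is 1, bounds the integral of
   [|f| ^ p] by that of [|f| ^ q] to the power [r^-1]. *)
have := hoelder P mfp (measurable_cst (1%R : R)) r0 s0 rs1.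
rewrite Lnorm_cst1 [X in X `^ _^-1^-1]probability_setT poweR1r mule1 Lnorm1.
rewrite unlock /Lnorm.
under eq_integral do rewrite /= mulr1 ger0_norm ?powR_ge0//.
under [in leRHS]eq_integral do
  rewrite /= ger0_norm ?powR_ge0// -powRrM mulrCA divff// mulr1.
(* Taking [p]-th roots gives the claim, because [r^-1 * p^-1 = q^-1]. *)
move=> H; apply: (@le_trans _ _ (((\int[P]_x (`|f x| `^ q)%:E) `^ r^-1) `^ p^-1)).
  apply: le_poweR => //; first by rewrite invr_ge0 ltW.
  by apply: integral_ge0 => x _; rewrite lee_fin powR_ge0.
by rewrite -poweRrM /r invf_div -mulrA mulrCA divff// mulr1.
Qed.

Lemma norm2_ge0 (R : realType) (n : nat) (x : 'cV[R]_n) : (0 <= norm2 x)%R.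
Proof. exact: sqrtr_ge0. Qed.

Lemma measurable_coord (R : realType) (n : nat) (i : 'I_n) :
  measurable_fun setT (fun x : euclid R n => (x : 'cV[R]_n) i ord0).
Proof.
apply: (measurability _ (RGenOpens.measurableE R)).
move=> _ [_ [a [b ->] <-]]; rewrite setTI; apply: sub_sigma_algebra.
have /continuousP := @coord_continuous R n 1 i ord0; apply.
exact: interval_open.
Qed.

(** Stated for a map [g] with measurable coordinates, so that it serves both for the norm on
    [euclid R n] and for the distance on the product space. *)
Lemma measurable_norm2 (d : measure_display) (T : measurableType d)
    (R : realType) (n : nat) (g : T -> 'cV[R]_n) :
  (forall i, measurable_fun setT (fun x => g x i ord0)) ->
  measurable_fun setT (fun x => norm2 (g x)).
Proof.
move=> mg; apply: (@measurableT_comp _ _ _ _ _ _ (@Num.sqrt R)).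
  by apply: continuous_measurable_fun; exact: sqrt_continuous.
by apply: measurable_sum => i; exact: measurable_funX.
Qed.

Lemma measurable_dist2 (R : realType) (n : nat) :
  measurable_fun setT
    (fun xy : euclid R n * euclid R n => norm2 (xy.1 - xy.2)%R).
Proof.
apply: measurable_norm2 => i; under eq_fun do rewrite !mxE.
apply: measurable_funB.
  exact: (measurableT_comp (measurable_coord R n i) measurable_fst).
exact: (measurableT_comp (measurable_coord R n i) measurable_snd).
Qed.

(** For finite [p] the two sides differ by a [p]-th root, which preserves finiteness in both
    directions. *)
Lemma finite_moment_Lnorm (R : realType) (n : nat) (p : \bar R)
    (mu : probability (euclid R n) R) : 1 <= p ->
  finite_moment p mu <-> 'N[mu]_p[EFin \o (fun x : euclid R n => norm2 x)] < +oo.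
Proof.
case: p => [p| |//] p1; rewrite /finite_moment.
  have pV0 : (p^-1 != 0)%R.
    by rewrite invr_eq0 gt_eqF// (lt_le_trans ltr01).
  rewrite Lnorm_nneg; last by move=> x; exact: norm2_ge0.
  by split=> [|/lty_poweRy]; [exact: poweR_lty|exact].
by rewrite Lnormy_nneg// => x; exact: norm2_ge0.
Qed.

Lemma finite_moment_le (R : realType) (n : nat) (p q : \bar R)
    (mu : probability (euclid R n) R) : 1 <= p -> p <= q ->
  finite_moment q mu -> finite_moment p mu.
Proof.
move=> p1 pq /(finite_moment_Lnorm _ _ _ _ (le_trans p1 pq)) qmu.
apply/finite_moment_Lnorm => //; apply: le_lt_trans qmu.
apply: le_Lnorm_probability => //.
by apply: measurable_norm2 => i; exact: measurable_coord.
Qed.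

(** Moving the root inside the infimum puts finite and infinite exponents in one form, in which
    different exponents can be compared coupling by coupling. *)
Lemma wasserstein_Lnorm (R : realType) (n : nat) (p : \bar R)
    (mu nu : probability (euclid R n) R) : 1 <= p ->
  wasserstein p mu nu =
  ereal_inf [set 'N[gamma]_p[EFin \o
    (fun xy : euclid R n * euclid R n => norm2 (xy.1 - xy.2)%R)]
    | gamma in coupling mu nu].
Proof.
case: p => [p| |//] p1; rewrite /wasserstein.
  have p0 : (0 < p)%R by rewrite (lt_le_trans ltr01).
  rewrite poweR_ereal_inf ?invr_gt0//; last first.
    by move=> _ [g _ <-]; apply: integral_ge0 => x _; rewrite lee_fin powR_ge0.
  rewrite image_comp; congr ereal_inf; apply: eq_imagel => g _ /=.
  by rewrite Lnorm_nneg// => x; exact: norm2_ge0.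
congr ereal_inf; apply: eq_imagel => g _.
by rewrite Lnormy_nneg// => x; exact: norm2_ge0.
Qed.

Lemma wasserstein_le (R : realType) (n : nat) (p q : \bar R)
    (mu nu : probability (euclid R n) R) : 1 <= p -> p <= q ->
  wasserstein p mu nu <= wasserstein q mu nu.
Proof.
move=> p1 pq; rewrite !wasserstein_Lnorm ?(le_trans p1)//.
apply/ereal_infP => _ [g cg <-].
apply: (@le_trans _ _ ('N[g]_p[EFin \o
    (fun xy : euclid R n * euclid R n => norm2 (xy.1 - xy.2)%R)])).
  by apply: ereal_inf_lbound; exists g.
by apply: le_Lnorm_probability => //; exact: measurable_dist2.
Qed.

Theorem mainTheorem4 (R : realType) (m n : nat) (hmn : (m <= n)%N)
  (p q : \bar R) (hp : 1 <= p) (hq : 1 <= q) (hpq : p <= q)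
  (mu : probability (euclid R m) R) (nu : probability (euclid R n) R)
  (hmu : finite_moment q mu) (hnu : finite_moment q nu) :
  augW_minus p mu nu <= augW_minus q mu nu /\
  augW_plus p mu nu <= augW_plus q mu nu.
Proof.
split; apply/ereal_infP => _ [a Pa <-].
  (* [Phi_minus] does not depend on the exponent, so the same projection [a] competes in both
     infima. *)
  apply: (@le_trans _ _ (wasserstein p mu a)); last exact: wasserstein_le.
  by apply: ereal_inf_lbound; exists a.
apply: (@le_trans _ _ (wasserstein p a nu)); last exact: wasserstein_le.
(* [Phi_plus] depends on the exponent through the moment condition alone, so [a] keeps its affine
   map. *)
apply: ereal_inf_lbound; exists a => //.
by case: Pa => qa Va; split=> //; exact: finite_moment_le qa.
Qed.
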